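(* Let $1<\gamma<3$. Consider the duct flow system with initial data $U_-=(p_-,u_-,S_-,a_0)$ for $x<x_1$, $U_m=(p_m,u_m,S_m,a_0)$ for $x_1<x<x_2$, $U_+=(p_+,u_+,S_+,a_1)$ for $x>x_2$, where $U_-$ and $U_m$ are connected by a contact discontinuity $J(U_m,U_-)$ with $u_-=u_m>0$, $p_-=p_m$, $\rho_-\neq\rho_m$, and $U_m$ and $U_+$ are connected by a stationary wave $S_0(U_+,U_m)$. Suppose that $U_m$ and $U_-$ are both supersonic: $u_m>c_m$, $u_->c_-$. Then, when the contact discontinuity touches the stationary wave, $U_-$ jumps by a stationary wave to the supersonic state $U_{-*}=(p_{-*},u_{-*},S_-,a_1)$. More specifically: Case 1. If $\rho_->\rho_m$, there are two subcases. Subcase 1. If $u_{-*}+\frac{2}{\gamma-1}c_{-*}>u_+-\frac{2}{\gamma-1}c_+$, then the interaction result is $$J(U_m,U_-)\oplus S_0(U_+,U_m)\rightarrow S_0(U_{-*},U_-)\oplus R_1(U_2,U_{-*})\oplus J(\overline U_2,U_2)\oplus R_3(U_+,\overline U_2)$$ for some states $U_2,\overline U_2$ with cross-section $a_1$. Subcase 2. If $u_{-*}+\frac{2}{\gamma-1}c_{-*}\le u_+-\frac{2}{\gamma-1}c_+$, then there is a vacuum and the interaction result is $$J(U_m,U_-)\oplus S_0(U_+,U_m)\rightarrow S_0(U_{-*},U_-)\oplus R_1(\mathrm{Vacuum},U_{-*})\oplus R_3(U_+,\mathrm{Vacuum}).$$ Case 2. If $\rho_-<\rho_m$, the interaction result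 is $$J(U_m,U_-)\oplus S_0(U_+,U_m)\rightarrow S_0(U_{-*},U_-)\oplus S_1(U_3,U_{-*})\oplus J(\overline U_3,U_3)\oplus S_3(U_+,\overline U_3)$$ for some states $U_3,\overline U_3$ with cross-section $a_1$.
   Context: System: $$(a\rho)_t+(a\rho u)_x=0,\quad (a\rho u)_t+(a\rho u^2+ap)_x=p\,a_x,\quad (a\rho E)_t+(au(\rho E+p))_x=0,\quad a_t=0,$$ with cross-section $a>0$, density $\rho$, velocity $u$, pressure $p$, total energy $E=e+\frac12u^2$, internal energy $e=\frac{p\tau}{\gamma-1}$, $\tau=1/\rho$, and equation of state $p=\kappa(S)\rho^\gamma$, $\kappa(S)=(\gamma-1)\exp((S-S_* )/C_v)$ with constants $S_*,C_v$. States are $U=(p,u,S,a)$ (with $\rho$ a function of $(p,S)$), sound speed $c=\sqrt{\gamma p/\rho}$; subscripts and other decorations on $\rho,c,p,u$ match those of the state. A state is supersonic if $|u|>c$ and subsonic if $|u|<c$. Elementary waves; in all of them the second argument $U_0=(p_0,u_0,S_0,a_0)$ is the left state and the first argument $U=(p,u,S,a)$ the right state. Across $R_1,R_3,S_1,S_3,J$ the cross-section $a$ is constant. - Stationary wave $S_0(U,U_0)$ (speed $0$, located at the jump of $a$, $a\neq a_0$): $a_0\rho_0u_0=a\rho u$, $\frac{u_0^2}{2}+\frac{c_0^2}{\gamma-1}=\frac{u^2}{2}+\frac{c^2}{\gamma-1}$, $p_0/\rho_0^\gamma=p/\rho^\gamma$, and (global entropy condition) both states lie in the closure of the same one of the regions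 $D_1=\{u>c\}$, $D_2=\{0<u<c\}$, $D_3=\{-c<u<0\}$, $D_4=\{u<-c\}$. - Contact discontinuity $J(U,U_0)$: $u=u_0$, $p=p_0$, $\rho\ne\rho_0$; speed $u_0$. - Rarefaction waves (with $S=S_0$, $\kappa=\kappa(S_0)$): $R_1(U,U_0)$: $u=u_0-\frac{2\sqrt{\gamma\kappa^{1/\gamma}}}{\gamma-1}\bigl(p^{\frac{\gamma-1}{2\gamma}}-p_0^{\frac{\gamma-1}{2\gamma}}\bigr)$, $p<p_0$ (backward, characteristic speed $u-c$); $R_3(U,U_0)$: $u=u_0+\frac{2\sqrt{\gamma\kappa^{1/\gamma}}}{\gamma-1}\bigl(p^{\frac{\gamma-1}{2\gamma}}-p_0^{\frac{\gamma-1}{2\gamma}}\bigr)$, $p>p_0$ (forward, characteristic speed $u+c$). $R_1(\mathrm{Vacuum},U_0)$ is the complete backward rarefaction from $U_0$ down to $p=0$ and $R_3(U,\mathrm{Vacuum})$ the complete forward rarefaction from $p=0$ up to $U$; between them $\rho=0$. - Shock waves, with $\mu^2=\frac{\gamma-1}{\gamma+1}$ and $\tau=\frac{\tau_0(\mu^2p+p_0)}{p+\mu^2p_0}$: $S_1(U,U_0)$: $u=u_0-(p-p_0)\sqrt{\frac{(1-\mu^2)\tau_0}{p+\mu^2p_0}}$, $p>p_0$ (backward); $S_3(U,U_0)$: $u=u_0+(p-p_0)\sqrt{\frac{(1-\mu^2)\tau_0}{p+\mu^2p_0}}$, $p<p_0$ (forward). Shock speeds are given by the Rankine–Hugoniot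 condition $\sigma[\rho]=[\rho u]$. Notation: $\oplus$ means ''is followed by'' (waves listed from left to right). ''$J(U_m,U_-)\oplus S_0(U_+,U_m)\rightarrow B$'' (interaction result) means: at the moment when the contact discontinuity reaches the stationary wave at $x=x_2$, the new Riemann problem centered there, with left state $U_-$ (cross-section $a_0$) and right state $U_+$ (cross-section $a_1$), is solved by the sequence of elementary waves $B$, arranged from left to right. $U_{-*}$ denotes the supersonic state with cross-section $a_1$ connected on the right to $U_-$ by a stationary wave.
   Formalization: The cross-section is assumed to increase, a_0 < a_1; for a_1 < a_0 the stated interaction results never hold, since the order of u_{-*} and u_+ is then reversed (and in Case 2 U_{-*} may fail to exist). *)

(* Defs.v *)
From Stdlib Require Import Reals List Sorted.
Import ListNotations.
Open Scope R_scope.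

(** [Rpower x y] is [exp (y * ln x)], hence meaningful only for
    [0 < x]; below it is applied to positive arguments only, and the value of
    a power of the pressure at [p = 0] is written directly as [0]. *)

Record gas := Gas_constants { gamma : R; S_star : R; C_v : R }.

Record state := State { pressure : R; velocity : R; entropy : R; area : R }.

Definition gas_state (U : state) : Prop := 0 < pressure U /\ 0 < area U.

Definition kappa (g : gas) (s : R) : R :=
  (gamma g - 1) * exp ((s - S_star g) / C_v g).

(** The positive solution [rho] of [p = kappa(S) * rho ^ gamma]. *)
Definition density (g : gas) (U : state) : R :=
  Rpower (pressure U / kappa g (entropy U)) (/ gamma g).

Definition specific_volume (g : gas) (U : state) : R := / density g U.

Definition sound_speed (g : gas) (U : state) : R :=
  sqrt (gamma g * pressure U / density g U).

Definition supersonic (g : gas) (U : state) : Prop :=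
  sound_speed g U < Rabs (velocity U).

Inductive region := D1 | D2 | D3 | D4.

(** Closures of [D1 = {u > c}], [D2 = {0 < u < c}], [D3 = {- c < u < 0}] and
    [D4 = {u < - c}] in the set of gas states. *)
Definition in_closure (g : gas) (D : region) (U : state) : Prop :=
  let u := velocity U in
  let c := sound_speed g U in
  match D with
  | D1 => c <= u
  | D2 => 0 <= u <= c
  | D3 => - c <= u <= 0
  | D4 => u <= - c
  end.

(** What can be found next to a wave: a constant gas state, or vacuum. *)
Inductive medium := Gas (U : state) | Vacuum.
Coercion Gas : state >-> medium.

(** In every wave the first argument is the right state and the second one the
    left state.  Only a backward rarefaction can end, and only a forward
    rarefaction can start, at the vacuum. *)
Inductive wave :=
  | Stationary (U U0 : state)
  | Contact (U U0 : state)
  | Rarefaction1 (U : medium) (U0 : state)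
  | Rarefaction3 (U : state) (U0 : medium)
  | Shock1 (U U0 : state)
  | Shock3 (U U0 : state).

Definition left_medium (w : wave) : medium :=
  match w with
  | Stationary _ U0 | Contact _ U0 | Rarefaction1 _ U0
  | Shock1 _ U0 | Shock3 _ U0 => Gas U0
  | Rarefaction3 _ M0 => M0
  end.

Definition right_medium (w : wave) : medium :=
  match w with
  | Stationary U _ | Contact U _ | Rarefaction3 U _
  | Shock1 U _ | Shock3 U _ => Gas U
  | Rarefaction1 M _ => M
  end.

Definition stationary_relation (g : gas) (U U0 : state) : Prop :=
  area U <> area U0 /\
  area U0 * density g U0 * velocity U0 = area U * density g U * velocity U /\
  velocity U0 ^ 2 / 2 + sound_speed g U0 ^ 2 / (gamma g - 1) =
    velocity U ^ 2 / 2 + sound_speed g U ^ 2 / (gamma g - 1) /\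
  pressure U0 / Rpower (density g U0) (gamma g) =
    pressure U / Rpower (density g U) (gamma g) /\
  exists D : region, in_closure g D U0 /\ in_closure g D U.

Definition contact_relation (g : gas) (U U0 : state) : Prop :=
  area U = area U0 /\ velocity U = velocity U0 /\
  pressure U = pressure U0 /\ density g U <> density g U0.

Definition rarefaction_coef (g : gas) (s : R) : R :=
  2 * sqrt (gamma g * Rpower (kappa g s) (/ gamma g)) / (gamma g - 1).

Definition pressure_power (g : gas) (p : R) : R :=
  Rpower p ((gamma g - 1) / (2 * gamma g)).

Definition rarefaction1_relation (g : gas) (U U0 : state) : Prop :=
  area U = area U0 /\ entropy U = entropy U0 /\
  pressure U < pressure U0 /\
  velocity U = velocity U0
    - rarefaction_coef g (entropy U0)
      * (pressure_power g (pressure U) - pressure_power g (pressure U0)).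

Definition rarefaction3_relation (g : gas) (U U0 : state) : Prop :=
  area U = area U0 /\ entropy U = entropy U0 /\
  pressure U > pressure U0 /\
  velocity U = velocity U0
    + rarefaction_coef g (entropy U0)
      * (pressure_power g (pressure U) - pressure_power g (pressure U0)).

Definition mu_sq (g : gas) : R := (gamma g - 1) / (gamma g + 1).

Definition hugoniot (g : gas) (U U0 : state) : Prop :=
  specific_volume g U =
    specific_volume g U0 * (mu_sq g * pressure U + pressure U0)
      / (pressure U + mu_sq g * pressure U0).

Definition shock_velocity_jump (g : gas) (U U0 : state) : R :=
  (pressure U - pressure U0)
  * sqrt ((1 - mu_sq g) * specific_volume g U0
          / (pressure U + mu_sq g * pressure U0)).

Definition shock1_relation (g : gas) (U U0 : state) : Prop :=
  area U = area U0 /\ hugoniot g U U0 /\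
  pressure U > pressure U0 /\
  velocity U = velocity U0 - shock_velocity_jump g U U0.

Definition shock3_relation (g : gas) (U U0 : state) : Prop :=
  area U = area U0 /\ hugoniot g U U0 /\
  pressure U < pressure U0 /\
  velocity U = velocity U0 + shock_velocity_jump g U U0.

Definition gas_medium (M : medium) : Prop :=
  match M with Gas U => gas_state U | Vacuum => True end.

Definition elementary_wave (g : gas) (w : wave) : Prop :=
  gas_medium (left_medium w) /\ gas_medium (right_medium w) /\
  match w with
  | Stationary U U0 => stationary_relation g U U0
  | Contact U U0 => contact_relation g U U0
  | Rarefaction1 (Gas U) U0 => rarefaction1_relation g U U0
  | Rarefaction1 Vacuum _ => True
  | Rarefaction3 U (Gas U0) => rarefaction3_relation g U U0
  | Rarefaction3 _ Vacuum => True
  | Shock1 U U0 => shock1_relation g U U0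
  | Shock3 U U0 => shock3_relation g U U0
  end.

(** From the Rankine-Hugoniot condition [sigma [rho] = [rho u]]. *)
Definition shock_speed (g : gas) (U U0 : state) : R :=
  (density g U * velocity U - density g U0 * velocity U0)
  / (density g U - density g U0).

(** A wave centred at the origin occupies the set
    [slow_speed <= x / t <= fast_speed].  At the vacuum end of a rarefaction
    the characteristic speed is the velocity given by the rarefaction formula
    with [p = 0], since [c = 0] there. *)
Definition slow_speed (g : gas) (w : wave) : R :=
  match w with
  | Stationary _ _ => 0
  | Contact _ U0 => velocity U0
  | Rarefaction1 _ U0 => velocity U0 - sound_speed g U0
  | Rarefaction3 _ (Gas U0) => velocity U0 + sound_speed g U0
  | Rarefaction3 U Vacuum =>
      velocity U
      - rarefaction_coef g (entropy U) * pressure_power g (pressure U)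
  | Shock1 U U0 | Shock3 U U0 => shock_speed g U U0
  end.

Definition fast_speed (g : gas) (w : wave) : R :=
  match w with
  | Stationary _ _ => 0
  | Contact _ U0 => velocity U0
  | Rarefaction1 (Gas U) _ => velocity U - sound_speed g U
  | Rarefaction1 Vacuum U0 =>
      velocity U0
      + rarefaction_coef g (entropy U0) * pressure_power g (pressure U0)
  | Rarefaction3 U _ => velocity U + sound_speed g U
  | Shock1 U U0 | Shock3 U U0 => shock_speed g U U0
  end.

(** The constant state between two successive waves fills a nondegenerate
    sector; a vacuum sector may shrink to a single ray. *)
Definition precedes (g : gas) (w w' : wave) : Prop :=
  match right_medium w with
  | Gas _ => fast_speed g w < slow_speed g w'
  | Vacuum => fast_speed g w <= slow_speed g w'
  end.

Fixpoint connects (g : gas) (Ml : medium) (B : list wave) (Mr : medium)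
    : Prop :=
  match B with
  | [] => Ml = Mr
  | w :: B' => left_medium w = Ml /\ elementary_wave g w /\
               connects g (right_medium w) B' Mr
  end.

Definition solves_riemann (g : gas) (Ul Ur : state) (B : list wave) : Prop :=
  connects g Ul B Ur /\ Sorted (precedes g) B.

(** [J(Um,Ul) + S_0(Ur,Um) -> B]: the contact discontinuity issued from [x1]
    reaches the stationary wave at [x2] at some time [t > 0], and the Riemann
    problem then centred at [(x2, t)] is solved by [B]. *)
Definition interaction_result
    (g : gas) (x1 x2 : R) (Ul Um Ur : state) (B : list wave) : Prop :=
  elementary_wave g (Contact Um Ul) /\
  elementary_wave g (Stationary Ur Um) /\
  exists t : R,
    0 < t /\ x1 + velocity Ul * t = x2 /\ solves_riemann g Ul Ur B.

Definition supersonic_image (g : gas) (a1 : R) (U V : state) : Prop :=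
  supersonic g V /\ area V = a1 /\ elementary_wave g (Stationary V U).

(* Main.v *)
Require Import Defs.
From Stdlib Require Import Reals List Sorted.
From Stdlib Require Import Ranalysis5 Lra Psatz.
From Coquelicot Require Import Coquelicot.
Import ListNotations.
Open Scope R_scope.

(** Write [u], [p] for the common velocity and pressure of [Ul] and [Um],
    [k = gamma - 1] and [r = a0 / a1 < 1].

    Nozzle flow.  A stationary wave is isentropic and conserves mass and total
    enthalpy, so it is determined by its velocity ratio [w]: density is
    multiplied by [r / w], pressure by [(r / w) ^ gamma], and the enthalpy
    balance becomes the scalar equation [expands].  On the supersonic branch
    the mass flux at constant enthalpy decreases with the velocity
    ([flux_decreasing]).  Hence a supersonic flow in a widening duct
    accelerates ([1 < w]), [w] is unique, and for given [u] a larger sound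
    speed gives a larger [w] ([expands_strict_mono]).  Let [a] and [b] be the
    ratios for [Ul] and [Um].  As [p] and [u] are common, the denser of the two
    states has the smaller sound speed: [a < b] in Case 1 and [b < a] in
    Case 2.

    Case 1.  Here [V] has the larger pressure and the smaller velocity.  Along
    rarefactions the velocity is affine in [pressure_power], so the middle
    pressure is explicit.  It is positive exactly when there is no vacuum, and
    it lies below the pressure of [Ur] because the backward rarefaction from
    [V] reaches that pressure with a velocity below [b * u]
    ([rarefaction_reaches]): [V] is supersonic, and
    [1 - (a / b) ^ (k / 2) <= k / 2 * (b / a - 1)].

    Case 2.  Here [V] has the smaller pressure and the larger velocity, and the
    middle pressure is found by the intermediate value theorem between two
    pressures.  The lower one is the pressure of [Ur], where the backward shock
    from [V] still leaves a velocity above [b * u].  The upper one is the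
    pressure behind a standing shock at [V]; staying below it is what makes the
    backward shock move to the right, away from the stationary wave.  Both
    bounds ([shock_reaches]) come from conservation: the square of the velocity
    jump is the pressure jump times the drop of specific volume, and a shock
    compresses less than an isentrope ([compression_le_isentropic]); behind a
    standing shock the velocity is below [u] while the pressure exceeds
    [r * p].

    The two states beside the contact discontinuity differ in density: in
    Case 1 because the entropies of [Ul] and [Um] differ, in Case 2 because
    compressing in two shocks is at least as effective as in one
    ([compression_submul]): at the pressure of [Ur] the gas coming from [V] is
    still the lighter one, and so it remains. *)

(** * Elementary real analysis *)

Lemma ln_le_sub1 (x : R) : 0 < x -> ln x <= x - 1.
Proof.
  intros Hx. pose proof (exp_ineq1_le (ln x)) as H.
  rewrite exp_ln in H by exact Hx. lra.
Qed.

Lemma Rpower_pos (x y : R) : 0 < Rpower x y.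
Proof. apply exp_pos. Qed.

Ltac pos := repeat first
  [ assumption | apply Rpower_pos | apply exp_pos | lra | apply Rmult_lt_0_compat | apply Rdiv_lt_0_compat
  | apply Rinv_0_lt_compat | apply pow_lt | apply sqrt_lt_R0 ].

Lemma Rdiv_between_0_1 (x y : R) : 0 < x < y -> 0 < x / y < 1.
Proof.
  intros H. split; [pos|]. apply Rmult_lt_reg_r with y; [lra|]. field_simplify; lra.
Qed.

Lemma ln_Rpower (x y : R) : ln (Rpower x y) = y * ln x.
Proof. apply ln_exp. Qed.

Lemma Rpower_lt_1 (x y : R) : 0 < x < 1 -> 0 < y -> Rpower x y < 1.
Proof.
  intros [H0 H1] Hy. unfold Rpower. rewrite <- exp_0. apply exp_increasing.
  assert (ln x < 0) by (rewrite <- ln_1; apply ln_increasing; lra). nra.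
Qed.

Lemma Rpower_lt_l (x y e : R) : 0 < e -> 0 < x < y -> Rpower x e < Rpower y e.
Proof.
  intros He [Hx Hxy]. apply exp_increasing, Rmult_lt_compat_l; [exact He|].
  apply ln_increasing; lra.
Qed.

Lemma zero_between (f : R -> R) (x y : R) :
  (forall z, x <= z <= y -> ex_derive f z) -> x < y -> f x < 0 -> 0 < f y ->
  exists z, x < z < y /\ f z = 0.
Proof.
  intros Hf Hxy Hx Hy. destruct (IVT_interv f x y) as [z [Hz Hfz]]; trivial.
  - intros z Hz. apply continuity_pt_filterlim, (ex_derive_continuous f). auto.
  - exists z. split; [|exact Hfz].
    assert (z <> x) by (intros ->; lra). assert (z <> y) by (intros ->; lra). lra.
Qed.

Lemma one_sub_Rpower_le (t e : R) : 0 < t -> 0 < e -> 1 - Rpower t e <= e * (/ t - 1).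
Proof.
  intros Ht He. pose proof (exp_ineq1_le (e * ln t)) as H.
  pose proof (ln_le_sub1 (/ t) ltac:(pos)) as H'. rewrite ln_Rinv in H' by exact Ht.
  unfold Rpower. nra.
Qed.

(** * Supersonic flow through a widening duct *)

(** At constant total enthalpy the squared sound speed drops from [x] to [y]
    while the velocity rises from [u] to [v]; the density is proportional to
    [c ^ (2 / k)], so [u ^ k * c ^ 2] is a power of the mass flux.  In logarithms
    the claim follows from [ln t <= t - 1] alone, since [x <= u ^ 2] says that
    the flow is supersonic from [u] on. *)
Lemma flux_decreasing (k u v x y : R) :
  0 < k -> 0 < u < v -> 0 < y -> x <= u ^ 2 ->
  x - y = k / 2 * (v ^ 2 - u ^ 2) ->
  Rpower v k * y < Rpower u k * x.
Proof.
  intros Hk [Hu Huv] Hy Hxu He.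
  assert (Hx : 0 < x).
  { assert (0 < v ^ 2 - u ^ 2) by nra. nra. }
  apply ln_lt_inv; try (apply Rmult_lt_0_compat; auto using Rpower_pos).
  rewrite !ln_mult, !ln_Rpower by (auto using Rpower_pos).
  pose proof (ln_le_sub1 (y / x) ltac:(apply Rdiv_lt_0_compat; lra)) as H1.
  rewrite ln_div in H1 by lra.
  assert (H2 : ln v - ln u < (v ^ 2 / u ^ 2 - 1) / 2).
  { rewrite <- ln_div by lra.
    pose proof (ln_le_sub1 (v / u) ltac:(apply Rdiv_lt_0_compat; lra)) as H.
    assert (Ht : 1 < v / u) by (apply Rmult_lt_reg_r with u; [lra|]; field_simplify; lra).
    replace (v ^ 2 / u ^ 2) with ((v / u) ^ 2) by (field; lra).
    assert (0 < (v / u - 1) ^ 2) by (apply pow_lt; lra). lra. }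
  assert (H3 : (v ^ 2 / u ^ 2 - 1) * (k / 2) <= 1 - y / x).
  { replace (1 - y / x) with ((x - y) / x) by (field; lra). rewrite He.
    replace ((v ^ 2 / u ^ 2 - 1) * (k / 2)) with (k / 2 * (v ^ 2 - u ^ 2) / u ^ 2) by (field; lra).
    apply Rmult_le_compat_l.
    - assert (0 < v ^ 2 - u ^ 2) by nra. nra.
    - apply Rinv_le_contravar; lra. }
  nra.
Qed.

(** The enthalpy balance of a supersonic flow with velocity [u] and sound speed
    [c] crossing into a duct wider by the factor [1 / r], in terms of the
    velocity ratio [w]: by mass conservation the density ratio is [r / w], hence
    the new squared sound speed is [c ^ 2 * (r / w) ^ k]. *)
Definition expands (k r u c w : R) : Prop :=
  1 < w /\ k / 2 * u ^ 2 * (w ^ 2 - 1) = c ^ 2 * (1 - Rpower (r / w) k).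

Lemma expands_exists (k r u c : R) :
  0 < k -> 0 < r < 1 -> 0 < u -> 0 < c -> exists w, expands k r u c w.
Proof.
  intros Hk Hr Hu Hc.
  (* The velocity ratio [W] would need more than all of the thermal enthalpy. *)
  set (W := 1 + 2 * c ^ 2 / (k * u ^ 2)).
  assert (HW : 1 < W).
  { unfold W. assert (0 < 2 * c ^ 2 / (k * u ^ 2)); [|lra].
    pos. }
  set (f := fun w => k / 2 * u ^ 2 * (w ^ 2 - 1) - c ^ 2 * (1 - exp (k * ln (r / w)))).
  destruct (zero_between f 1 W) as [w [Hw Hf]].
  - intros w Hw. unfold f. auto_derive.
    split; [lra|]. split; [|exact I]. pos.
  - exact HW.
  - unfold f. replace (r / 1) with r by field.
    pose proof (Rpower_lt_1 r k Hr Hk) as H. unfold Rpower in H.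
    assert (0 < c ^ 2 * (1 - exp (k * ln r))) by pos. lra.
  - unfold f. pose proof (exp_pos (k * ln (r / W))) as H.
    assert (HE : k / 2 * u ^ 2 * (W - 1) = c ^ 2) by (unfold W; field; lra).
    assert (0 < k / 2 * u ^ 2 * ((W - 1) * W)) by pos.
    assert (0 < c ^ 2 * exp (k * ln (r / W))) by pos. nra.
  - exists w. split; [lra|]. unfold f in Hf. unfold Rpower. lra.
Qed.

Lemma expands_lt_1 (k r u c w : R) :
  0 < k -> 0 < u -> 0 < c -> expands k r u c w -> Rpower (r / w) k < 1.
Proof.
  intros Hk Hu Hc [Hw E].
  assert (0 < w ^ 2 - 1) by nra.
  assert (0 < c ^ 2) by pos.
  assert (0 < k / 2 * u ^ 2 * (w ^ 2 - 1)) by pos.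
  nra.
Qed.

(** A hotter gas has more thermal enthalpy to convert into velocity.  If [w2 < w1]
    held, then the gas with sound speed [c1], accelerated by the factor [w2]
    only, would be left with the squared sound speed [x] and carry no more mass
    than prescribed by the area ratio, while its flux must still decrease up to
    [w1]. *)
Lemma expands_mono (k r u c1 c2 w1 w2 : R) :
  0 < k -> 0 < r -> 0 < u -> 0 < c1 <= c2 -> c1 <= u ->
  expands k r u c1 w1 -> expands k r u c2 w2 -> w1 <= w2.
Proof.
  intros Hk Hr Hu Hc Hcu X1 X2.
  pose proof (expands_lt_1 k r u c2 w2 Hk Hu ltac:(lra) X2) as Hq2.
  destruct X1 as [H1 E1], X2 as [H2 E2].
  apply Rnot_lt_le. intros Hlt.
  assert (Q : forall w, 0 < w -> Rpower (w * u) k * Rpower (r / w) k = Rpower (r * u) k).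
  { intros w Hw. rewrite Rpower_mult_distr by pos.
    f_equal. field. lra. }
  assert (K1 := Q w1 ltac:(lra)). assert (K2 := Q w2 ltac:(lra)). clear Q.
  set (q1 := Rpower (r / w1) k) in *. set (q2 := Rpower (r / w2) k) in *.
  assert (P1 : 0 < q1) by apply Rpower_pos.
  assert (c1 ^ 2 <= c2 ^ 2) by (apply pow_incr; lra).
  set (x := c1 ^ 2 - k / 2 * u ^ 2 * (w2 ^ 2 - 1)).
  assert (Hx : x <= c1 ^ 2 * q2) by (unfold x; nra).
  assert (HF : Rpower (w1 * u) k * (c1 ^ 2 * q1) < Rpower (w2 * u) k * x).
  { apply flux_decreasing; try lra.
    - split; [pos|]. apply Rmult_lt_compat_r; lra.
    - pos.
    - assert (c1 ^ 2 <= u ^ 2) by (apply pow_incr; lra).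
      assert (0 < w2 ^ 2 - 1) by nra.
      assert (0 < k / 2 * u ^ 2 * (w2 ^ 2 - 1)) by pos.
      assert (u ^ 2 <= (w2 * u) ^ 2) by (apply pow_incr; nra). unfold x. lra.
    - unfold x. nra. }
  assert (Rpower (w2 * u) k * x <= Rpower (w2 * u) k * (c1 ^ 2 * q2))
    by (apply Rmult_le_compat_l; [left; apply Rpower_pos | exact Hx]).
  nra.
Qed.

Lemma expands_strict_mono (k r u c1 c2 w1 w2 : R) :
  0 < k -> 0 < r -> 0 < u -> 0 < c1 < c2 -> c1 <= u ->
  expands k r u c1 w1 -> expands k r u c2 w2 -> w1 < w2.
Proof.
  intros Hk Hr Hu Hc Hcu X1 X2.
  destruct (expands_mono k r u c1 c2 w1 w2) as [Hlt | Heq]; try assumption; try lra.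
  exfalso. subst w2.
  pose proof (expands_lt_1 k r u c1 w1 Hk Hu ltac:(lra) X1).
  destruct X1 as [Hw E1], X2 as [_ E2].
  assert (0 < (c2 ^ 2 - c1 ^ 2) * (1 - Rpower (r / w1) k)); [|lra].
  apply Rmult_lt_0_compat; nra.
Qed.

(** * The equation of state *)

Lemma kappa_pos (g : gas) (s : R) : 1 < gamma g -> 0 < kappa g s.
Proof. intros Hg. unfold kappa. pos. Qed.

Lemma kappa_inj (g : gas) (s s' : R) :
  1 < gamma g -> C_v g <> 0 -> kappa g s = kappa g s' -> s = s'.
Proof.
  unfold kappa. intros Hg HC H. apply Rmult_eq_reg_l in H; [|lra].
  apply exp_inv in H. apply Rmult_eq_reg_r in H; [lra|].
  apply Rinv_neq_0_compat; exact HC.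
Qed.

Lemma density_pos (g : gas) (U : state) : 0 < density g U.
Proof. apply Rpower_pos. Qed.

Lemma pressure_over_density_power (g : gas) (U : state) :
  1 < gamma g -> 0 < pressure U ->
  pressure U / Rpower (density g U) (gamma g) = kappa g (entropy U).
Proof.
  intros Hg Hp. pose proof (kappa_pos g (entropy U) Hg).
  unfold density. rewrite Rpower_mult, Rinv_l, Rpower_1 by (try lra; pos).
  field. lra.
Qed.

(** Since the velocity and the area do not enter the equation of state, any positive
    density can be prescribed at a given pressure by choosing the entropy. *)
Lemma entropy_of_density (g : gas) (p rho : R) :
  1 < gamma g -> C_v g <> 0 -> 0 < p -> 0 < rho ->
  exists s, forall u a, density g (State p u s a) = rho.
Proof.
  intros Hg HC Hp Hr.
  exists (S_star g + C_v g * ln (p / Rpower rho (gamma g) / (gamma g - 1))).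
  intros u a. unfold density, kappa; simpl.
  match goal with |- context [exp ?x] =>
    replace x with (ln (p / Rpower rho (gamma g) / (gamma g - 1))) by (field; exact HC) end.
  rewrite exp_ln by pos.
  replace (p / _) with (Rpower rho (gamma g)).
  - rewrite Rpower_mult, Rinv_r, Rpower_1; lra.
  - field. repeat split; try lra. apply Rgt_not_eq, Rpower_pos.
Qed.

Lemma sound_speed_pos (g : gas) (U : state) :
  1 < gamma g -> 0 < pressure U -> 0 < sound_speed g U.
Proof. intros Hg Hp. pose proof (density_pos g U). unfold sound_speed. pos. Qed.

Lemma sound_speed_sq (g : gas) (U : state) :
  1 < gamma g -> 0 < pressure U ->
  sound_speed g U ^ 2 = gamma g * pressure U / density g U.
Proof.
  intros Hg Hp. pose proof (density_pos g U). apply pow2_sqrt. left. pos.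
Qed.

Lemma isentropic_scaling (g : gas) (U V : state) (t : R) :
  1 < gamma g -> 0 < pressure U -> 0 < t ->
  entropy V = entropy U -> pressure V = pressure U * Rpower t (gamma g) ->
  density g V = t * density g U /\
  sound_speed g V ^ 2 = sound_speed g U ^ 2 * Rpower t (gamma g - 1).
Proof.
  intros Hg Hp Ht HS HV. pose proof (kappa_pos g (entropy U) Hg) as Hk.
  assert (Hd : density g V = t * density g U).
  { unfold density. rewrite HS, HV.
    replace (pressure U * Rpower t (gamma g) / kappa g (entropy U))
      with (Rpower t (gamma g) * (pressure U / kappa g (entropy U))) by (field; lra).
    rewrite <- Rpower_mult_distr by pos.
    rewrite (Rpower_mult t), Rinv_r, Rpower_1 by lra. reflexivity. }
  split; [exact Hd|].
  pose proof (density_pos g U).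
  rewrite !sound_speed_sq, Hd, HV by (try assumption; rewrite HV; pos).
  unfold Rminus. rewrite Rpower_plus, Rpower_Ropp, Rpower_1 by lra. field. lra.
Qed.

Lemma rarefaction_coef_pos (g : gas) (s : R) : 1 < gamma g -> 0 < rarefaction_coef g s.
Proof. intros Hg. unfold rarefaction_coef. pos. Qed.

(** Links the Riemann invariants in terms of the pressure, used for the waves, to
    those in terms of the sound speed, used for the vacuum criterion. *)
Lemma rarefaction_coef_pressure_power (g : gas) (U : state) :
  1 < gamma g -> 0 < pressure U ->
  rarefaction_coef g (entropy U) * pressure_power g (pressure U)
  = 2 / (gamma g - 1) * sound_speed g U.
Proof.
  intros Hg Hp. pose proof (kappa_pos g (entropy U) Hg) as Hk.
  unfold rarefaction_coef, pressure_power, sound_speed, density.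
  set (K := kappa g (entropy U)) in *. set (p := pressure U) in *.
  assert (E : sqrt (gamma g * Rpower K (/ gamma g)) * Rpower p ((gamma g - 1) / (2 * gamma g))
              = sqrt (gamma g * p / Rpower (p / K) (/ gamma g))).
  { symmetry. apply sqrt_lem_1.
    - left. pos.
    - left. pos.
    - match goal with |- ?s * ?q * (?s * ?q) = _ =>
        replace (s * q * (s * q)) with ((s * s) * (q * q)) by ring end.
      rewrite sqrt_def by (left; pos). rewrite <- Rpower_plus.
      apply ln_inv; [pos | pos |].
      rewrite !ln_div, !ln_mult, !ln_Rpower, !ln_div by pos. field. lra. }
  rewrite <- E. field. lra.
Qed.

(** * Stationary waves from supersonic states *)

Definition expanded (g : gas) (r w a1 : R) (U : state) : state :=
  State (pressure U * Rpower (r / w) (gamma g)) (w * velocity U) (entropy U) a1.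

Lemma expanded_sound_speed (g : gas) (r w a1 : R) (U : state) :
  1 < gamma g -> 0 < pressure U -> 0 < velocity U -> 0 < r ->
  expands (gamma g - 1) r (velocity U) (sound_speed g U) w ->
  let V := expanded g r w a1 U in
  density g V = r / w * density g U /\
  sound_speed g V ^ 2
    = sound_speed g U ^ 2 - (gamma g - 1) / 2 * velocity U ^ 2 * (w ^ 2 - 1) /\
  sound_speed g V < sound_speed g U.
Proof.
  intros Hg Hp Hu Hr Hx V.
  pose proof (sound_speed_pos g U Hg Hp) as Hc.
  pose proof (expands_lt_1 (gamma g - 1) r (velocity U) (sound_speed g U) w
    ltac:(lra) Hu Hc Hx) as Hlt.
  destruct Hx as [Hw He].
  destruct (isentropic_scaling g U V (r / w)) as [Hd Hs]; try assumption; try reflexivity; [pos|].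
  split; [exact Hd|]. split; [rewrite He, Hs; ring|].
  apply Rnot_le_lt. intros H.
  assert (0 < sound_speed g U ^ 2 * (1 - Rpower (r / w) (gamma g - 1))) by pos.
  assert (sound_speed g U ^ 2 <= sound_speed g V ^ 2) by (apply pow_incr; lra).
  lra.
Qed.

(** The entropy condition keeps the right state in the closure of [D1], where the
    flux is decreasing: a velocity below that of [U] would carry at least the
    mass flux of [U], which is impossible in the wider duct.  This excludes
    the decelerating solution of the balance laws, so that the wave is described
    by [expands]. *)
Lemma supersonic_stationary_iff (g : gas) (U V : state) :
  1 < gamma g -> C_v g <> 0 -> gas_state U -> 0 < velocity U -> supersonic g U ->
  area U < area V ->
  let r := area U / area V in
  elementary_wave g (Stationary V U) <->
  exists w, expands (gamma g - 1) r (velocity U) (sound_speed g U) w /\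
    V = expanded g r w (area V) U.
Proof.
  intros Hg HC HU Hu Hs Ha r. destruct HU as [HpU HaU].
  unfold supersonic in Hs. rewrite Rabs_pos_eq in Hs by lra.
  assert (Hr : 0 < r < 1).
  { apply Rdiv_between_0_1. lra. }
  pose proof (sound_speed_pos g U Hg HpU) as HcU. pose proof (density_pos g U) as HdU.
  split.
  - intros [[_ _] [[HpV HaV] [_ [Hm [He [HS [D HD]]]]]]]. simpl in HpV, HaV.
    pose proof (sound_speed_pos g V Hg HpV) as HcV. pose proof (density_pos g V) as HdV.
    rewrite !pressure_over_density_power in HS by assumption.
    apply kappa_inj in HS; try assumption. symmetry in HS.
    assert (HcuV : sound_speed g V <= velocity V).
    { destruct HD as [HD1 HD2]; destruct D; simpl in *; lra. }
    set (w := velocity V / velocity U).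
    assert (Hw0 : 0 < w) by (unfold w; pos).
    assert (HvV : velocity V = w * velocity U) by (unfold w; field; lra).
    assert (Hd : density g V = (r / w) * density g U).
    { unfold w, r. apply Rmult_eq_reg_r with (area V * velocity V); [|apply Rgt_not_eq; pos].
      transitivity (area V * density g V * velocity V); [ring|]. rewrite <- Hm. field. 
      repeat split; lra. }
    assert (HpV' : pressure V = pressure U * Rpower (r / w) (gamma g)).
    { pose proof (pressure_over_density_power g V Hg HpV) as H1.
      pose proof (pressure_over_density_power g U Hg HpU) as H2.
      rewrite HS, <- H2, Hd, <- Rpower_mult_distr in H1 by pos.
      assert (0 < Rpower (r / w) (gamma g)) by pos.
      assert (0 < Rpower (density g U) (gamma g)) by pos.
      apply Rmult_eq_reg_r with (/ (Rpower (r / w) (gamma g) * Rpower (density g U) (gamma g)));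
        [|apply Rgt_not_eq; pos].
      etransitivity; [exact H1|]. field. lra. }
    destruct (isentropic_scaling g U V (r / w)) as [_ Hc]; try assumption; [pos|].
    exists w. split.
    + assert (He' : (gamma g - 1) / 2 * velocity U ^ 2 * (w ^ 2 - 1)
                    = sound_speed g U ^ 2 - sound_speed g V ^ 2).
      { rewrite HvV in He. set (k := gamma g - 1) in *.
        assert (Hk : k <> 0) by (unfold k; lra).
        apply (Rmult_eq_compat_l k) in He. field_simplify in He; [|lra|lra]. lra. }
      split.
      * (* No deceleration: compare the mass fluxes. *)
        apply Rnot_le_lt. intros [Hw1 | Hw1].
        -- pose proof (flux_decreasing (gamma g - 1) (velocity V) (velocity U)
             (sound_speed g V ^ 2) (sound_speed g U ^ 2)) as HF.
           assert (Hlt : velocity V < velocity U) by (rewrite HvV; nra).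
           assert (HF' := HF ltac:(lra) ltac:(lra) ltac:(pos) ltac:(apply pow_incr; lra)
             ltac:(rewrite HvV; lra)). clear HF.
           rewrite Hc, HvV, Rmult_comm, (Rmult_comm (Rpower (w * _) _)), Rmult_assoc in HF'.
           apply Rmult_lt_reg_l in HF'; [|pos].
           rewrite Rpower_mult_distr in HF' by pos.
           replace (r / w * (w * velocity U)) with (r * velocity U) in HF' by (field; lra).
           assert (Rpower (r * velocity U) (gamma g - 1) < Rpower (velocity U) (gamma g - 1));
             [|lra]. apply Rpower_lt_l; [lra|]. split; [pos|]. nra.
        -- rewrite Hw1 in Hc, He'. replace (r / 1) with r in Hc by field.
           assert (Rpower r (gamma g - 1) < 1) by (apply Rpower_lt_1; lra).
           assert (0 < sound_speed g U ^ 2 * (1 - Rpower r (gamma g - 1))) by pos. lra.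
      * rewrite He', Hc. ring.
    + destruct V as [pV uV sV aV]; unfold expanded; simpl in *; congruence.
  - intros [w [Hx HV]].
    destruct (expanded_sound_speed g r w (area V) U Hg HpU Hu (proj1 Hr) Hx) as [Hd [Hc HcV]].
    rewrite <- HV in Hd, Hc, HcV. destruct Hx as [Hw _].
    assert (HpV : pressure V = pressure U * Rpower (r / w) (gamma g)) by (rewrite HV; reflexivity).
    assert (HvV : velocity V = w * velocity U) by (rewrite HV; reflexivity).
    assert (HSV : entropy V = entropy U) by (rewrite HV; reflexivity). clear HV.
    assert (Hp : 0 < pressure V) by (rewrite HpV; pos).
    split; [split; assumption|]. split; [split; simpl; [assumption|lra]|].
    split; [lra|]. split; [|split; [|split]].
    + rewrite Hd, HvV. unfold r. field. split; lra.
    + rewrite HvV, Hc. field. lra.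
    + rewrite !pressure_over_density_power, HSV by assumption. reflexivity.
    + exists D1. simpl. split; [lra|]. rewrite HvV. nra.
Qed.

Lemma supersonic_image_iff (g : gas) (a1 : R) (U V : state) :
  1 < gamma g -> C_v g <> 0 -> gas_state U -> 0 < velocity U -> supersonic g U ->
  area U < a1 ->
  supersonic_image g a1 U V <->
  exists w, expands (gamma g - 1) (area U / a1) (velocity U) (sound_speed g U) w /\
    V = expanded g (area U / a1) w a1 U.
Proof.
  intros Hg HC HU Hu Hs Ha.
  destruct HU as [HpU HaU]. split.
  - intros [_ [Haa HV]]. subst a1.
    apply supersonic_stationary_iff in HV; try assumption. split; assumption.
  - intros [w [Hx HV]].
    assert (Haa : area V = a1) by (rewrite HV; reflexivity). subst a1.
    assert (HcU : sound_speed g U < velocity U)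
      by (unfold supersonic in Hs; rewrite Rabs_pos_eq in Hs; lra).
    assert (Hr : 0 < area U / area V) by pos.
    destruct (expanded_sound_speed g (area U / area V) w (area V) U Hg HpU Hu Hr Hx)
      as [_ [_ HcV]]. rewrite <- HV in HcV.
    assert (HuV : velocity V = w * velocity U) by (rewrite HV; reflexivity).
    split; [|split; [reflexivity|]].
    + unfold supersonic. destruct Hx as [Hw _]. rewrite HuV, Rabs_pos_eq; nra.
    + apply supersonic_stationary_iff; try assumption; [split; assumption|].
      exists w. split; assumption.
Qed.

Lemma supersonic_image_exists_unique (g : gas) (a1 : R) (U : state) :
  1 < gamma g -> C_v g <> 0 -> gas_state U -> 0 < velocity U -> supersonic g U ->
  area U < a1 -> exists! V : state, supersonic_image g a1 U V.
Proof.
  intros Hg HC HU Hu Hs Ha.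
  pose proof (supersonic_image_iff g a1 U) as Himg.
  pose proof (sound_speed_pos g U Hg (proj1 HU)) as HcU.
  assert (Hcu : sound_speed g U < velocity U)
    by (unfold supersonic in Hs; rewrite Rabs_pos_eq in Hs; lra).
  assert (Hr : 0 < area U / a1 < 1).
  { destruct HU as [_ HaU]. apply Rdiv_between_0_1. lra. }
  destruct (expands_exists (gamma g - 1) (area U / a1) (velocity U) (sound_speed g U))
    as [w Hw]; try assumption; [lra|].
  exists (expanded g (area U / a1) w a1 U). split.
  - apply Himg; try assumption. exists w. split; [exact Hw|reflexivity].
  - intros V HV. apply Himg in HV; try assumption. destruct HV as [w' [Hw' ->]].
    replace w' with w; [reflexivity|].
    apply Rle_antisym;
      apply (expands_mono (gamma g - 1) (area U / a1) (velocity U) (sound_speed g U)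
        (sound_speed g U)); try assumption; lra.
Qed.

(** * Riemann problems solved by two rarefactions *)

Ltac order_waves :=
  repeat apply Sorted_cons; try apply Sorted_nil; try apply HdRel_nil; try apply HdRel_cons;
  unfold precedes; simpl.

(** The Riemann invariants are affine in [x = pressure_power p], so the meeting
    point of the two rarefaction curves is the solution of a linear equation:
    [x > 0] is the absence of vacuum, and the last hypothesis says that the
    curves have already crossed at the lower of the two given pressures. *)
Lemma two_rarefactions (g : gas) (V W : state) :
  1 < gamma g -> gas_state V -> gas_state W -> area V = area W ->
  kappa g (entropy V) <> kappa g (entropy W) ->
  pressure W < pressure V ->
  velocity V + 2 / (gamma g - 1) * sound_speed g V
    > velocity W - 2 / (gamma g - 1) * sound_speed g W ->
  velocity V + rarefaction_coef g (entropy V)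
    * (pressure_power g (pressure V) - pressure_power g (pressure W)) < velocity W ->
  exists U Ubar : state,
    area U = area W /\ area Ubar = area W /\
    connects g V [Rarefaction1 U V; Contact Ubar U; Rarefaction3 W Ubar] W /\
    Sorted (precedes g) [Rarefaction1 U V; Contact Ubar U; Rarefaction3 W Ubar].
Proof.
  intros Hg [HpV HaV] [HpW HaW] Ha HK Hp Hvac Hmeet.
  rewrite <- !rarefaction_coef_pressure_power in Hvac by assumption.
  pose proof (rarefaction_coef_pos g (entropy V) Hg) as HA.
  pose proof (rarefaction_coef_pos g (entropy W) Hg) as HB.
  set (A := rarefaction_coef g (entropy V)) in *.
  set (B := rarefaction_coef g (entropy W)) in *.
  set (PV := pressure_power g (pressure V)) in *.
  set (PW := pressure_power g (pressure W)) in *.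
  set (x := (velocity V + A * PV - velocity W + B * PW) / (A + B)).
  assert (Hx : 0 < x) by (unfold x; pos).
  assert (HxE : x * (A + B) = velocity V + A * PV - velocity W + B * PW)
    by (unfold x; field; lra).
  assert (HxW : x < PW) by (apply Rmult_lt_reg_r with (A + B); lra).
  set (p := Rpower x (2 * gamma g / (gamma g - 1))).
  assert (Hp0 : 0 < p) by apply Rpower_pos.
  assert (Hpx : pressure_power g p = x).
  { unfold p, pressure_power. rewrite Rpower_mult.
    replace (2 * gamma g / (gamma g - 1) * ((gamma g - 1) / (2 * gamma g))) with 1
      by (field; lra). apply Rpower_1. exact Hx. }
  assert (HpW' : p < pressure W).
  { apply Rnot_le_lt. intros H. apply (Rlt_irrefl x). apply Rlt_le_trans with PW; [exact HxW|].
    rewrite <- Hpx. apply Rle_Rpower_l; [|lra]. apply Rlt_le. pos. }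
  set (u := velocity V + A * (PV - x)).
  exists (State p u (entropy V) (area W)), (State p u (entropy W) (area W)).
  split; [reflexivity|]. split; [reflexivity|]. split.
  - repeat split; simpl; try assumption; try reflexivity; try lra.
    + fold A. rewrite Hpx. unfold u. fold PV. ring.
    + intros Hd.
      pose proof (pressure_over_density_power g (State p u (entropy V) (area W)) Hg Hp0) as K1.
      pose proof (pressure_over_density_power g (State p u (entropy W) (area W)) Hg Hp0) as K2.
      rewrite Hd in K2. simpl in K1, K2. apply HK. rewrite <- K1, <- K2. reflexivity.
    + fold B. rewrite Hpx. fold PW. unfold u. lra.
  - pose proof (sound_speed_pos g (State p u (entropy V) (area W)) Hg Hp0).
    pose proof (sound_speed_pos g (State p u (entropy W) (area W)) Hg Hp0).
    order_waves; lra.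
Qed.

Lemma two_rarefactions_vacuum (g : gas) (V W : state) :
  1 < gamma g -> gas_state V -> gas_state W ->
  velocity V + 2 / (gamma g - 1) * sound_speed g V
    <= velocity W - 2 / (gamma g - 1) * sound_speed g W ->
  connects g V [Rarefaction1 Vacuum V; Rarefaction3 W Vacuum] W /\
  Sorted (precedes g) [Rarefaction1 Vacuum V; Rarefaction3 W Vacuum].
Proof.
  intros Hg HV HW Hvac. split.
  - repeat split; simpl; apply HV || apply HW.
  - order_waves.
    rewrite !rarefaction_coef_pressure_power; try apply HV; try apply HW; assumption.
Qed.

(** * Riemann problems solved by two shocks *)

(** The density ratio [rho / rho0] across a shock between the pressures [p0] and
    [p], as prescribed by [hugoniot]. *)
Definition compression (g : gas) (p p0 : R) : R :=
  (p + mu_sq g * p0) / (mu_sq g * p + p0).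

Lemma mu_sq_bounds (g : gas) : 1 < gamma g -> 0 < mu_sq g < 1.
Proof.
  intros Hg. unfold mu_sq. split; [pos|].
  apply Rmult_lt_reg_r with (gamma g + 1); [lra|]. field_simplify; lra.
Qed.

Lemma compression_gt_1 (g : gas) (p p0 : R) :
  1 < gamma g -> 0 < p0 < p -> 1 < compression g p p0.
Proof.
  intros Hg Hp. pose proof (mu_sq_bounds g Hg) as Hm. unfold compression.
  assert (0 < mu_sq g * p) by pos. assert (0 < (1 - mu_sq g) * (p - p0)) by pos.
  apply Rmult_lt_reg_r with (mu_sq g * p + p0); [lra|]. rewrite Rmult_1_l. unfold Rdiv. rewrite Rmult_assoc, Rinv_l, Rmult_1_r by lra. lra.
Qed.

(** Shocks lose efficiency with strength: reaching [p2] through an intermediate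
    pressure compresses at least as much as doing it in one shock. *)
Lemma compression_submul (g : gas) (p0 p1 p2 : R) :
  1 < gamma g -> 0 < p0 <= p1 -> p1 <= p2 ->
  compression g p2 p0 <= compression g p1 p0 * compression g p2 p1.
Proof.
  intros Hg H01 H12. pose proof (mu_sq_bounds g Hg) as Hm. unfold compression.
  set (m := mu_sq g) in *. clearbody m.
  assert (0 < m * p1) by pos. assert (0 < m * p2) by pos.
  match goal with |- ?x <= ?y => 
    assert (E : y - x = m * (1 - m) * (p2 - p0) * (p1 - p0) * (p2 - p1)
      / ((m * p1 + p0) * (m * p2 + p1) * (m * p2 + p0))) by (field; lra) end.
  assert (0 <= m * (1 - m) * (p2 - p0) * (p1 - p0) * (p2 - p1)
      / ((m * p1 + p0) * (m * p2 + p1) * (m * p2 + p0))); [|lra].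
  apply Rmult_le_pos; [repeat apply Rmult_le_pos; lra|].
  apply Rlt_le. pos.
Qed.

(** The entropy grows across a compressive shock.  In terms of [z = p / p0], the
    logarithmic gap [h] between the two compressions vanishes at [z = 1], and the
    numerator of its derivative is [m * (z - 1) ^ 2], a perfect square because
    [gamma = (1 + m) / (1 - m)]. *)
Lemma compression_le_isentropic (g : gas) (p p0 : R) :
  1 < gamma g -> 0 < p0 < p -> compression g p p0 <= Rpower (p / p0) (/ gamma g).
Proof.
  intros Hg Hp. pose proof (mu_sq_bounds g Hg) as Hm.
  set (z := p / p0). assert (Hz : 1 < z).
  { unfold z. apply Rmult_lt_reg_r with p0; [lra|]. field_simplify; lra. }
  unfold compression. set (m := mu_sq g) in *.
  replace ((p + m * p0) / (m * p + p0)) with ((z + m) / (m * z + 1)).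
  2:{ unfold z. assert (0 < m * p) by pos. field. lra. }
  set (h := fun x => / gamma g * ln x + ln (m * x + 1) - ln (x + m)).
  assert (Hh : 0 <= h z).
  { destruct (MVT_gen h 1 z (fun x => / gamma g / x + m / (m * x + 1) - 1 / (x + m)))
      as [x [Hx E]].
    - intros x Hx. rewrite Rmin_left in Hx by lra.
      assert (0 < m * x) by pos.
      unfold h. auto_derive; [lra|]. field. lra.
    - intros x Hx. rewrite Rmin_left in Hx by lra.
      assert (0 < m * x) by pos.
      apply continuity_pt_filterlim, (ex_derive_continuous h). unfold h. auto_derive. lra.
    - rewrite Rmin_left, Rmax_right in Hx by lra.
      replace (h 1) with 0 in E.
      2:{ unfold h. rewrite ln_1, (Rplus_comm 1 m), Rmult_1_r. ring. }
      assert (Hd : / gamma g / x + m / (m * x + 1) - 1 / (x + m)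
        = m * (x - 1) ^ 2 / (gamma g * x * (m * x + 1) * (x + m))).
      { assert (Hgm : gamma g = (1 + m) / (1 - m)) by (unfold m, mu_sq; field; lra).
        assert (0 < m * x) by pos. clearbody m. rewrite Hgm. field. lra. }
      rewrite Hd in E. rewrite Rminus_0_r in E. rewrite E.
      apply Rmult_le_pos; [|lra]. apply Rmult_le_pos.
      + apply Rmult_le_pos; [lra|apply pow2_ge_0].
      + assert (0 < m * x) by pos. apply Rlt_le. pos. }
  assert (0 < m * z) by pos.
  apply Rnot_lt_le. intros H'. apply ln_increasing in H'; [|pos].
  rewrite ln_Rpower, ln_div in H' by lra. unfold h in Hh. lra.
Qed.

(** The reciprocal of the relative mass flux through a shock; the velocity jump is
    the pressure jump times this factor. *)
Definition shock_slope (g : gas) (U : state) (p : R) : R :=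
  sqrt ((1 - mu_sq g) * specific_volume g U / (p + mu_sq g * pressure U)).

(** The pressure behind the shock of speed zero ahead of which the state is [U]. *)
Definition standing_shock_pressure (g : gas) (U : state) : R :=
  (1 - mu_sq g) * density g U * velocity U ^ 2 - mu_sq g * pressure U.

(** The two shock curves cross between the pressure of [W], where the curve of [V]
    still lies above [velocity W], and the pressure behind the standing shock at
    [V], where it has fallen below.  A shock weaker than the standing one has
    positive speed because the oncoming flow [V] outruns it. *)
Lemma two_shocks (g : gas) (V W : state) :
  1 < gamma g -> C_v g <> 0 -> gas_state V -> gas_state W -> area V = area W ->
  pressure V < pressure W ->
  velocity W < velocity V
    - (pressure W - pressure V) * shock_slope g V (pressure W) ->
  density g V * compression g (pressure W) (pressure V) < density g W ->
  0 < velocity V ->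
  pressure W < standing_shock_pressure g V ->
  velocity V - (standing_shock_pressure g V - pressure V) / (density g V * velocity V)
    < velocity W ->
  exists U Ubar : state,
    area U = area W /\ area Ubar = area W /\
    connects g V [Shock1 U V; Contact Ubar U; Shock3 W Ubar] W /\
    Sorted (precedes g) [Shock1 U V; Contact Ubar U; Shock3 W Ubar] /\
    0 < shock_speed g U V.
Proof.
  intros Hg HC [HpV HaV] [HpW HaW] Ha Hp Hmeet Hrho HvV Hpn Hun.
  pose proof (mu_sq_bounds g Hg) as Hm.
  pose proof (density_pos g V) as HdV. pose proof (density_pos g W) as HdW.
  set (pn := standing_shock_pressure g V) in *.
  assert (Hslope : forall U p, 0 < pressure U -> 0 < p -> 0 < shock_slope g U p).
  { intros U p HU Hp'. pose proof (density_pos g U). unfold shock_slope, specific_volume.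
    assert (0 < mu_sq g * pressure U) by pos. pos. }
  destruct (zero_between (fun p => velocity W + (p - pressure W) * shock_slope g W p
    - (velocity V - (p - pressure V) * shock_slope g V p)) (pressure W) pn) as [p [Hpb E]].
  - intros p Hpb. unfold shock_slope, specific_volume.
    assert (0 < mu_sq g * pressure V) by pos. assert (0 < mu_sq g * pressure W) by pos.
    auto_derive. repeat split; try lra; pos.
  - exact Hpn.
  - rewrite Rminus_diag. lra.
  - (* At the standing shock the relative mass flux is [density g V * velocity V]. *)
    assert (HV : shock_slope g V pn = / (density g V * velocity V)).
    { unfold shock_slope.
      replace (pn + mu_sq g * pressure V) with ((1 - mu_sq g) * density g V * velocity V ^ 2)
        by (unfold pn, standing_shock_pressure; ring).
      unfold specific_volume. apply sqrt_lem_1; [apply Rlt_le; pos | apply Rlt_le; pos |].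
      field. lra. }
    rewrite HV. assert (0 < (pn - pressure W) * shock_slope g W pn)
      by (apply Rmult_lt_0_compat; [lra | apply Hslope; lra]).
    unfold Rdiv in Hun. lra.
  - assert (Hmp : 0 < mu_sq g * p) by pos.
    assert (HmV : 0 < mu_sq g * pressure V) by pos.
    assert (HmW : 0 < mu_sq g * pressure W) by pos.
    pose proof (compression_gt_1 g p (pressure V) Hg ltac:(lra)) as HcV.
    pose proof (compression_gt_1 g p (pressure W) Hg ltac:(lra)) as HcW.
    pose proof (Hslope V p HpV ltac:(lra)) as HsV.
    pose proof (Hslope W p HpW ltac:(lra)) as HsW.
    assert (HJV : 0 < (p - pressure V) * shock_slope g V p) by pos.
    assert (HJW : 0 < (p - pressure W) * shock_slope g W p) by pos.
    set (u := velocity V - (p - pressure V) * shock_slope g V p) in *.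
    set (d := density g V * compression g p (pressure V)).
    set (dbar := density g W * compression g p (pressure W)).
    assert (grow : forall x y, 0 < x -> 1 < y -> x < x * y) by (intros; nra).
    assert (HdV' : density g V < d) by (apply grow; assumption).
    assert (HdW' : density g W < dbar) by (apply grow; assumption).
    (* Compress from [V] to [p] in two steps and compare at the pressure of [W]. *)
    assert (Hdd : d < dbar).
    { pose proof (compression_submul g (pressure V) (pressure W) p Hg ltac:(lra) ltac:(lra)).
      unfold d, dbar. apply Rle_lt_trans with
        (density g V * compression g (pressure W) (pressure V) * compression g p (pressure W)).
      - rewrite Rmult_assoc. apply Rmult_le_compat_l; lra.
      - apply Rmult_lt_compat_r; lra. }
    destruct (entropy_of_density g p d Hg HC ltac:(lra) ltac:(lra)) as [s Hs].
    destruct (entropy_of_density g p dbar Hg HC ltac:(lra) ltac:(lra)) as [sbar Hsbar].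
    set (U := State p u s (area W)). set (Ubar := State p u sbar (area W)).
    assert (HU : density g U = d) by apply Hs.
    assert (HUbar : density g Ubar = dbar) by apply Hsbar.
    exists U, Ubar.
    split; [reflexivity|]. split; [reflexivity|]. split; [|split].
    + repeat split; simpl; try assumption; try reflexivity; try lra.
      * unfold hugoniot, specific_volume. rewrite HU. simpl. unfold d, compression. field. lra.
      * unfold hugoniot, specific_volume. rewrite HUbar. simpl. unfold dbar, compression.
        field. lra.
      * unfold shock_velocity_jump, specific_volume. rewrite HUbar. simpl.
        replace ((1 - mu_sq g) * / dbar / (pressure W + mu_sq g * p))
          with ((1 - mu_sq g) * specific_volume g W / (p + mu_sq g * pressure W)).
        -- fold (shock_slope g W p). lra.
        -- unfold dbar, compression, specific_volume. field. lra.
    + order_waves.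
      * unfold shock_speed. rewrite HUbar. simpl.
        apply Rmult_lt_reg_r with (dbar - density g W); [lra|].
        replace ((density g W * velocity W - dbar * u) / (density g W - dbar)
          * (dbar - density g W)) with (dbar * u - density g W * velocity W) by (field; lra).
        assert (0 < density g W * (u - velocity W)); [|lra].
        apply Rmult_lt_0_compat; lra.
      * unfold shock_speed. rewrite HU. simpl.
        apply Rmult_lt_reg_r with (d - density g V); [lra|].
        unfold Rdiv. rewrite Rmult_assoc, Rinv_l, Rmult_1_r by lra.
        assert (0 < density g V * (velocity V - u)); [|lra].
        apply Rmult_lt_0_compat; unfold u; lra.
    + unfold shock_speed. rewrite HU. simpl.
      apply Rdiv_lt_0_compat; [|lra].
      assert (Hflux : (p + mu_sq g * pressure V) * shock_slope g V p
                      < (1 - mu_sq g) * velocity V).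
      { apply Rsqr_incrst_0; [| apply Rlt_le; pos | apply Rlt_le; pos].
        unfold Rsqr at 1. unfold shock_slope.
        match goal with |- ?x * ?s * (?x * ?s) < _ =>
          replace (x * s * (x * s)) with (x ^ 2 * (s * s)) by ring end.
        unfold specific_volume. rewrite sqrt_def by (apply Rlt_le; pos).
        unfold pn, standing_shock_pressure in Hpb.
        apply Rmult_lt_reg_r with (density g V / (1 - mu_sq g)); [pos|].
        unfold Rsqr. field_simplify; [|lra|lra]. lra. }
      replace (d * u - density g V * velocity V) with
        (density g V * (p - pressure V) / (mu_sq g * p + pressure V)
         * ((1 - mu_sq g) * velocity V
            - (p + mu_sq g * pressure V) * shock_slope g V p)).
      * assert (0 < mu_sq g * p + pressure V) by lra. pos.
      * unfold d, u, compression. field. lra.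
Qed.

(** * Comparison of the nozzle flow with rarefactions and shocks *)

Lemma Rpower_div_lt (r x y e : R) : 0 < e -> 0 < r -> 0 < x < y ->
  Rpower (r / y) e < Rpower (r / x) e.
Proof.
  intros He Hr Hxy. apply Rpower_lt_l; [exact He|]. split; [pos|].
  apply Rmult_lt_compat_l; [exact Hr|]. apply Rinv_lt_contravar; [pos|lra].
Qed.

(** Expanding further from the ratio [a] to the ratio [b] through a rarefaction
    accelerates the gas less than the supersonic nozzle flow would: along the
    rarefaction [du = c * dw / w] in terms of the density ratio [1 / w], with
    [c] below its initial value, which is less than [a * u]. *)
Lemma rarefaction_reaches (g : gas) (r a b p u : R) (V : state) :
  1 < gamma g -> 0 < r -> 0 < p -> 0 < u -> 0 < a < b ->
  pressure V = p * Rpower (r / a) (gamma g) -> velocity V = a * u ->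
  sound_speed g V < velocity V ->
  velocity V + rarefaction_coef g (entropy V)
    * (pressure_power g (pressure V) - pressure_power g (p * Rpower (r / b) (gamma g)))
  < b * u.
Proof.
  intros Hg Hr Hp Hu Hab HpV HuV Hc.
  assert (HpV0 : 0 < pressure V) by (rewrite HpV; pos).
  pose proof (sound_speed_pos g V Hg HpV0) as Hc0.
  assert (E : p * Rpower (r / b) (gamma g) = pressure V * Rpower (a / b) (gamma g)).
  { rewrite HpV, Rmult_assoc, Rpower_mult_distr by pos. do 2 f_equal. field. lra. }
  assert (EP : pressure_power g (p * Rpower (r / b) (gamma g))
    = pressure_power g (pressure V) * Rpower (a / b) ((gamma g - 1) / 2)).
  { rewrite E. unfold pressure_power. rewrite <- Rpower_mult_distr, Rpower_mult by pos.
    do 2 f_equal. field. lra. }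
  rewrite EP.
  pose proof (rarefaction_coef_pressure_power g V Hg HpV0) as EC.
  replace (rarefaction_coef g (entropy V) * _)
    with (rarefaction_coef g (entropy V) * pressure_power g (pressure V)
          * (1 - Rpower (a / b) ((gamma g - 1) / 2))) by ring.
  rewrite EC.
  pose proof (one_sub_Rpower_le (a / b) ((gamma g - 1) / 2) ltac:(pos) ltac:(lra)) as H.
  rewrite Rinv_div in H.
  assert (H1 : 2 / (gamma g - 1) * sound_speed g V * (1 - Rpower (a / b) ((gamma g - 1) / 2))
    <= sound_speed g V * (b / a - 1)).
  { replace (sound_speed g V * (b / a - 1)) with
      (2 / (gamma g - 1) * sound_speed g V * ((gamma g - 1) / 2 * (b / a - 1))) by (field; lra).
    apply Rmult_le_compat_l; [apply Rlt_le; pos | exact H]. }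
  assert (Hba : 0 < b / a - 1).
  { replace (b / a - 1) with ((b - a) / a) by (field; lra). pos. }
  assert (H2 : sound_speed g V * (b / a - 1) < velocity V * (b / a - 1))
    by (apply Rmult_lt_compat_r; assumption).
  assert (H3 : velocity V * (b / a - 1) = b * u - a * u) by (rewrite HuV; field; lra).
  lra.
Qed.

(** The momentum that the nozzle flow gains between the ratios [b] and [a] exceeds
    what a shock needs to bridge the pressure difference.  With [p], [u], [rho] of
    [U], that difference is at most [gamma * r * (a - b) * p], the momentum
    gained per unit area is [r * rho * u * (a - b) * u], and
    [gamma * p < rho * u ^ 2] since [U] is supersonic.  For the standing shock,
    the enthalpy balance gives the velocity behind it in closed form, namely the
    squared critical speed over [a * u] (Prandtl's relation), and reduces the
    pressure bound [r * p] to [1 < a]. *)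
Lemma shock_reaches (g : gas) (r a b a1 : R) (U : state) :
  1 < gamma g -> 0 < r < 1 -> 0 < pressure U -> 0 < velocity U -> 1 < b < a ->
  sound_speed g U < velocity U ->
  expands (gamma g - 1) r (velocity U) (sound_speed g U) a ->
  let V := expanded g r a a1 U in
  let p := pressure U * Rpower (r / b) (gamma g) in
  pressure V < p /\
  density g V * compression g p (pressure V) <= r / b * density g U /\
  b * velocity U < velocity V - (p - pressure V) * shock_slope g V p /\
  p < standing_shock_pressure g V /\
  velocity V - (standing_shock_pressure g V - pressure V) / (density g V * velocity V)
    < b * velocity U.
Proof.
  intros Hg Hr Hp0 Hu Hab Hc Hx V p.
  destruct (expanded_sound_speed g r a a1 U Hg Hp0 Hu ltac:(lra) Hx) as [Hd [Hcs HcV]].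
  fold V in Hd, Hcs, HcV.
  pose proof (mu_sq_bounds g Hg) as Hm.
  pose proof (density_pos g U) as HdU. pose proof (density_pos g V) as HdV.
  pose proof (sound_speed_pos g U Hg Hp0) as HcU.
  assert (HpV : pressure V = pressure U * Rpower (r / a) (gamma g)) by reflexivity.
  assert (HuV : velocity V = a * velocity U) by reflexivity.
  assert (HpV0 : 0 < pressure V) by (rewrite HpV; pos).
  assert (Hp : 0 < p) by (unfold p; pos).
  assert (HpVp : pressure V < p).
  { unfold p. rewrite HpV. apply Rmult_lt_compat_l; [exact Hp0|]. apply Rpower_div_lt; lra. }
  assert (Hratio : p = pressure V * Rpower (a / b) (gamma g)).
  { unfold p. rewrite HpV, Rmult_assoc, Rpower_mult_distr by pos. do 2 f_equal. field. lra. }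
  assert (Hcomp : compression g p (pressure V) <= a / b).
  { eapply Rle_trans; [apply compression_le_isentropic; lra|].
    replace (p / pressure V) with (Rpower (a / b) (gamma g)) by (rewrite Hratio; field; lra).
    rewrite Rpower_mult, Rinv_r, Rpower_1 by (try lra; pos). lra. }
  assert (HcV2 : sound_speed g V ^ 2 = gamma g * pressure V / density g V)
    by (apply sound_speed_sq; assumption).
  assert (HcUs : sound_speed g U ^ 2 < velocity U ^ 2) by nra.
  assert (Hpr : gamma g * pressure U = sound_speed g U ^ 2 * density g U)
    by (rewrite sound_speed_sq by assumption; field; lra).
  assert (HpU : gamma g * pressure U < density g U * velocity U ^ 2) by nra.
  (* As [1 < b] and [1 < gamma]: [(r / b) ^ gamma < r]. *)
  assert (Hprr : p < pressure U * r).
  { unfold p. apply Rmult_lt_compat_l; [exact Hp0|].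
    apply Rlt_trans with (Rpower r (gamma g)).
    - apply Rpower_lt_l; [lra|]. split; [pos|].
      apply Rmult_lt_reg_r with b; [lra|]. unfold Rdiv. rewrite Rmult_assoc, Rinv_l; nra.
    - replace (gamma g) with ((gamma g - 1) + 1) by ring. rewrite Rpower_plus, Rpower_1 by lra.
      pose proof (Rpower_lt_1 r (gamma g - 1) Hr ltac:(lra)). nra. }
  split; [exact HpVp|]. split; [|split; [|split]].
  - rewrite Hd. replace (r / b * density g U) with (r / a * density g U * (a / b)) by (field; lra).
    apply Rmult_le_compat_l; [apply Rlt_le; pos | exact Hcomp].
  - assert (Hjump : p - pressure V < density g V * (a * velocity U) * ((a - b) * velocity U)).
    { assert (HpVb : pressure V = p * Rpower (b / a) (gamma g)).
      { rewrite Hratio, Rmult_assoc, Rpower_mult_distr by pos.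
        replace (a / b * (b / a)) with 1 by (field; lra).
        unfold Rpower. rewrite ln_1, Rmult_0_r, exp_0. ring. }
      pose proof (one_sub_Rpower_le (b / a) (gamma g) ltac:(pos) ltac:(lra)) as H.
      rewrite Rinv_div in H.
      assert (Hab' : a / b - 1 <= a - b).
      { replace (a / b - 1) with ((a - b) * / b) by (field; lra).
        assert (/ b < 1) by (rewrite <- Rinv_1; apply Rinv_lt_contravar; lra). nra. }
      apply Rle_lt_trans with (pressure U * r * (gamma g * (a - b))).
      - rewrite HpVb at 1.
        replace (p - p * Rpower (b / a) (gamma g)) with (p * (1 - Rpower (b / a) (gamma g))) by ring.
        apply Rle_trans with (p * (gamma g * (a - b))).
        + apply Rmult_le_compat_l; [lra|]. eapply Rle_trans; [exact H|].
          apply Rmult_le_compat_l; lra.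
        + apply Rmult_le_compat_r; [apply Rlt_le; pos | lra].
      - rewrite Hd.
        replace (r / a * density g U * (a * velocity U) * ((a - b) * velocity U))
          with (r * (a - b) * (density g U * velocity U ^ 2)) by (field; lra).
        replace (pressure U * r * (gamma g * (a - b)))
          with (r * (a - b) * (gamma g * pressure U)) by ring.
        apply Rmult_lt_compat_l; [pos | exact HpU]. }
    (* The squared jump is the pressure jump times the drop of specific volume, and that
       drop is at most the isentropic one, [(1 - b / a) / density g V]. *)
    assert (Hsq : (p - pressure V) * shock_slope g V p < (a - b) * velocity U).
    { assert (HmV : 0 < mu_sq g * pressure V) by pos.
      assert (Hmp : 0 < mu_sq g * p) by pos.
      apply Rsqr_incrst_0.
      2:{ apply Rmult_le_pos; [lra|apply sqrt_pos]. }
      2:{ apply Rlt_le; pos. }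
      unfold shock_slope, specific_volume.
      rewrite Rsqr_mult, Rsqr_sqrt by (apply Rlt_le; pos).
      apply Rle_lt_trans with ((p - pressure V) * / density g V * (1 - b / a)).
      - replace (Rsqr (p - pressure V) *
          ((1 - mu_sq g) * / density g V / (p + mu_sq g * pressure V)))
          with ((p - pressure V) * / density g V * (1 - / compression g p (pressure V)))
          by (unfold Rsqr, compression; field; lra).
        apply Rmult_le_compat_l; [apply Rlt_le; pos|].
        assert (/ (a / b) <= / compression g p (pressure V)); [|rewrite Rinv_div in *; lra].
        apply Rinv_le_contravar; [|exact Hcomp].
        pose proof (compression_gt_1 g p (pressure V) Hg ltac:(lra)). lra.
      - apply Rmult_lt_reg_r with (density g V * a); [pos|].
        replace ((p - pressure V) * / density g V * (1 - b / a) * (density g V * a))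
          with ((p - pressure V) * (a - b)) by (field; lra).
        replace (Rsqr ((a - b) * velocity U) * (density g V * a))
          with (density g V * (a * velocity U) * ((a - b) * velocity U) * (a - b))
          by (unfold Rsqr; ring).
        apply Rmult_lt_compat_r; [lra | exact Hjump]. }
    lra.
  - apply Rlt_trans with (pressure U * r); [exact Hprr|].
    set (G := gamma g) in *. set (c2 := sound_speed g U ^ 2) in *.
    set (u2 := velocity U ^ 2) in *.
    assert (Hu2 : 0 < u2) by (unfold u2; pos).
    assert (E : standing_shock_pressure g V - pressure U * r
      = r * density g U / (a * G * (G + 1))
        * (2 * G * a ^ 2 * u2 - (G - 1) * (c2 - (G - 1) / 2 * u2 * (a ^ 2 - 1)) - a * (G + 1) * c2)).
    { unfold standing_shock_pressure, mu_sq. fold G. rewrite HuV, Hd, Rpow_mult_distr.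
      fold u2.
      replace (pressure V) with (r / a * density g U * (c2 - (G - 1) / 2 * u2 * (a ^ 2 - 1)) / G).
      2:{ rewrite <- Hcs, <- Hd, HcV2. field. lra. }
      replace (pressure U) with (c2 * density g U / G) by (rewrite <- Hpr; field; lra).
      field. lra. }
    assert (0 < 2 * G * a ^ 2 * u2 - (G - 1) * (c2 - (G - 1) / 2 * u2 * (a ^ 2 - 1))
                - a * (G + 1) * c2).
    { assert (0 < a * (G + 1)) by pos. 
      assert (0 < (u2 - c2) * (a * (G + 1) + (G - 1))) by pos.
      assert (0 < 2 * G * a) by pos.
      assert (0 < u2 * ((a - 1) * (2 * G * a + (G - 1)))) by pos.
      assert (0 < a ^ 2 - 1) by nra.
      assert (0 < (G - 1) ^ 2 / 2 * u2 * (a ^ 2 - 1)) by pos. lra. }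
    assert (0 < standing_shock_pressure g V - pressure U * r); [|lra].
    rewrite E. pos.
  - set (G := gamma g) in *. set (c2 := sound_speed g U ^ 2) in *.
    assert (E : velocity V - (standing_shock_pressure g V - pressure V) / (density g V * velocity V)
      = ((G - 1) / (G + 1) * velocity U ^ 2 + 2 / (G + 1) * c2) / (a * velocity U)).
    { unfold standing_shock_pressure, mu_sq. fold G. rewrite HuV.
      replace (pressure V)
        with (density g V * (c2 - (G - 1) / 2 * velocity U ^ 2 * (a ^ 2 - 1)) / G).
      2:{ rewrite <- Hcs, HcV2. field. lra. }
      field. lra. }
    rewrite E. apply Rlt_trans with (velocity U ^ 2 / (a * velocity U)).
    + apply Rmult_lt_compat_r; [pos|].
      replace (velocity U ^ 2) with ((G - 1) / (G + 1) * velocity U ^ 2 + 2 / (G + 1) * velocity U ^ 2)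
        at 2 by (field; lra).
      apply Rplus_lt_compat_l, Rmult_lt_compat_l; [pos | exact HcUs].
    + replace (velocity U ^ 2 / (a * velocity U)) with (/ a * velocity U) by (field; lra).
      apply Rmult_lt_compat_r; [lra|].
      assert (/ a < 1) by (rewrite <- Rinv_1; apply Rinv_lt_contravar; lra). lra.
Qed.

(** * The interaction *)

(** The stationary wave occupies the ray of speed zero, so that any solution from
    [V] to [Ur] whose first wave moves to the right can follow it. *)
Lemma interaction_result_intro (g : gas) (x1 x2 : R) (Ul Um Ur V : state)
    (w : wave) (B : list wave) :
  x1 < x2 -> 0 < velocity Um ->
  elementary_wave g (Contact Um Ul) -> elementary_wave g (Stationary Ur Um) ->
  elementary_wave g (Stationary V Ul) ->
  connects g V (w :: B) Ur -> Sorted (precedes g) (w :: B) -> 0 < slow_speed g w ->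
  interaction_result g x1 x2 Ul Um Ur (Stationary V Ul :: w :: B).
Proof.
  intros Hx Hu HJ HS HV HB Hsort Hslow.
  split; [exact HJ|]. split; [exact HS|].
  assert (Huu : velocity Um = velocity Ul) by apply HJ.
  exists ((x2 - x1) / velocity Ul). split; [apply Rdiv_lt_0_compat; lra|].
  split; [field; lra|]. split.
  - split; [reflexivity|]. split; [exact HV | exact HB].
  - apply Sorted_cons; [exact Hsort|]. apply HdRel_cons. exact Hslow.
Qed.

Theorem lemma3p3 :
  forall (g : gas) (x1 x2 a0 a1 : R) (Ul Um Ur : state),
    1 < gamma g < 3 ->
    C_v g <> 0 ->
    x1 < x2 ->
    0 < a0 ->
    a0 < a1 ->
    area Ul = a0 ->
    area Um = a0 ->
    area Ur = a1 ->
    elementary_wave g (Contact Um Ul) ->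
    0 < velocity Um ->
    elementary_wave g (Stationary Ur Um) ->
    supersonic g Um ->
    supersonic g Ul ->
    (exists! V : state, supersonic_image g a1 Ul V) /\
    forall V : state,
      supersonic_image g a1 Ul V ->
      entropy V = entropy Ul /\
      (density g Ul > density g Um ->
        (velocity V + 2 / (gamma g - 1) * sound_speed g V
           > velocity Ur - 2 / (gamma g - 1) * sound_speed g Ur ->
         exists U2 U2bar : state,
           area U2 = a1 /\ area U2bar = a1 /\
           interaction_result g x1 x2 Ul Um Ur
             [Stationary V Ul; Rarefaction1 U2 V;
              Contact U2bar U2; Rarefaction3 Ur U2bar]) /\
        (velocity V + 2 / (gamma g - 1) * sound_speed g V
           <= velocity Ur - 2 / (gamma g - 1) * sound_speed g Ur ->
         interaction_result g x1 x2 Ul Um Ur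
           [Stationary V Ul; Rarefaction1 Vacuum V;
            Rarefaction3 Ur Vacuum])) /\
      (density g Ul < density g Um ->
        exists U3 U3bar : state,
          area U3 = a1 /\ area U3bar = a1 /\
          interaction_result g x1 x2 Ul Um Ur
            [Stationary V Ul; Shock1 U3 V;
             Contact U3bar U3; Shock3 Ur U3bar]).
Proof.
  intros g x1 x2 a0 a1 Ul Um Ur Hgam HC Hx Ha0 Ha HaUl HaUm HaUr HJ Hum HS Hsm Hsl.
  assert (Hg : 1 < gamma g) by lra.
  pose proof HJ as [HgUl [HgUm [_ [Huu [Hpp Hdd]]]]].
  change (gas_state Ul) in HgUl. change (gas_state Um) in HgUm.
  assert (Hul : 0 < velocity Ul) by lra.
  assert (HgUr : gas_state Ur) by apply HS.
  split; [apply supersonic_image_exists_unique; try assumption; lra|].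
  intros V HV.
  assert (HSV : elementary_wave g (Stationary V Ul)) by apply HV.
  assert (HgV : gas_state V) by apply HSV.
  apply supersonic_image_iff in HV; try assumption; [|lra].
  destruct HV as [w [Hw HV]].
  assert (HaV : area V = a1) by (rewrite HV; reflexivity).
  pose proof HS as HSm. apply supersonic_stationary_iff in HSm; try assumption; [|lra].
  destruct HSm as [wm [Hwm HUr]].
  rewrite HaUr, HaUm in HUr, Hwm. rewrite HaUl in HV, Hw.
  rewrite Huu in Hwm.
  pose proof (sound_speed_pos g Ul Hg (proj1 HgUl)) as Hcl0.
  pose proof (sound_speed_pos g Um Hg (proj1 HgUm)) as Hcm0.
  unfold supersonic in Hsl, Hsm. rewrite Rabs_pos_eq in Hsl, Hsm by lra. rewrite Huu in Hsm.
  set (r := a0 / a1) in *.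
  assert (Hr : 0 < r < 1).
  { apply Rdiv_between_0_1. lra. }
  destruct (expanded_sound_speed g r w a1 Ul Hg (proj1 HgUl) Hul (proj1 Hr) Hw) as [HdV [_ HcV]].
  rewrite <- HV in HdV, HcV.
  assert (HdUr : density g Ur = r / wm * density g Um).
  { rewrite <- Huu in Hwm.
    destruct (expanded_sound_speed g r wm a1 Um Hg (proj1 HgUm) Hum (proj1 Hr) Hwm) as [H _].
    rewrite <- HUr in H. exact H. }
  assert (HpV : pressure V = pressure Ul * Rpower (r / w) (gamma g)) by (rewrite HV; reflexivity).
  assert (HuV : velocity V = w * velocity Ul) by (rewrite HV; reflexivity).
  assert (HSVl : entropy V = entropy Ul) by (rewrite HV; reflexivity).
  assert (HpUr : pressure Ur = pressure Ul * Rpower (r / wm) (gamma g))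
    by (rewrite HUr, <- Hpp; reflexivity).
  assert (HuUr : velocity Ur = wm * velocity Ul) by (rewrite HUr, <- Huu; reflexivity).
  assert (HSUr : entropy Ur = entropy Um) by (rewrite HUr; reflexivity).
  assert (Hcu : sound_speed g V < velocity V).
  { destruct Hw as [Hw _]. rewrite HuV. nra. }
  (* At equal pressure the denser gas has the smaller sound speed. *)
  assert (HcU : forall U U' : state, 0 < pressure U -> pressure U = pressure U' ->
    density g U > density g U' -> sound_speed g U < sound_speed g U').
  { intros U U' HpU HpE Hd. unfold sound_speed. rewrite <- HpE.
    pose proof (density_pos g U'). apply sqrt_lt_1; [apply Rlt_le; pos | apply Rlt_le; pos |].
    apply Rmult_lt_compat_l; [pos|]. apply Rinv_lt_contravar; [pos|lra]. }
  split; [exact HSVl|]. split.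
  - intros Hd.
    assert (Hww : w < wm).
    { apply (expands_strict_mono (gamma g - 1) r (velocity Ul) (sound_speed g Ul)
        (sound_speed g Um)); try assumption; try lra.
      split; [exact Hcl0|]. apply HcU; [apply HgUl | lra | exact Hd]. }
    assert (Hw0 : 0 < w) by (destruct Hw; lra).
    split; intros Hvac.
    + destruct (two_rarefactions g V Ur) as [U2 [U2bar [HU2 [HU2bar [Hcon Hsort]]]]];
        try assumption; try congruence.
      * rewrite HSVl, HSUr. intros HK. apply Hdd. unfold density. rewrite Hpp, HK. reflexivity.
      * rewrite HpV, HpUr. apply Rmult_lt_compat_l; [apply HgUl|].
        apply Rpower_div_lt; lra.
      * rewrite HpUr, HuUr. apply (rarefaction_reaches g r w); try assumption; try lra.
        apply HgUl.
      * exists U2, U2bar. split; [congruence|]. split; [congruence|].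
        apply interaction_result_intro; try assumption. simpl. lra.
    + destruct (two_rarefactions_vacuum g V Ur) as [Hcon Hsort]; try assumption.
      apply interaction_result_intro; try assumption. simpl. lra.
  - intros Hd.
    assert (Hww : wm < w).
    { apply (expands_strict_mono (gamma g - 1) r (velocity Ul) (sound_speed g Um)
        (sound_speed g Ul)); try assumption; try lra.
      split; [exact Hcm0|]. apply HcU; [apply HgUm | lra | exact Hd]. }
    assert (Hwm0 : 1 < wm) by apply Hwm.
    destruct (shock_reaches g r w wm a1 Ul) as [H1 [H2 [H3 [H4 H5]]]]; try assumption;
      try lra; [apply HgUl|].
    rewrite <- HV, <- HpUr in *. rewrite <- HuUr in *.
    destruct (two_shocks g V Ur) as [U3 [U3bar [HU3 [HU3bar [Hcon [Hsort Hspeed]]]]]];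
      try assumption; try congruence; try lra.
    + eapply Rle_lt_trans; [exact H2|]. rewrite HdUr.
      apply Rmult_lt_compat_l; [pos | exact Hd].
    + rewrite HuV. pos.
    + exists U3, U3bar. split; [congruence|]. split; [congruence|].
      apply interaction_result_intro; try assumption.
Qed.
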